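(* If $S\subset\mathcal{S}_{\mathbb{R}}$ is a non-empty set of real numbers and $S$ has an upper bound in $\mathcal{S}_{\mathbb{R}}$ (with respect to $\le$), then $S$ has a least upper bound in $\mathcal{S}_{\mathbb{R}}$.
   Context: Conventions. $\omega=\{0,1,2,\dots\}$, $\omega_+=\omega\setminus\{0\}$, $[a,b]_\omega=\{n\in\omega:a\le n\le b\}$, $[a,\infty]_\omega=\{n\in\omega:n\ge a\}$. A system function $\vartheta:\omega_+\to[2,\infty]_\omega$ is fixed. Contractions. For $f:\omega\to\omega$ and $n\in\omega_+$, the contraction $c_n$ is applicable to $f$ iff $f(n+1)\ge\vartheta(n)$, and then $c_n(f)(n)=f(n)+1$, $c_n(f)(n+1)=f(n+1)-\vartheta(n)$, $c_n(f)(k)=f(k)$ for other $k$. A sequence of contractions is a finite (possibly empty) composition of contractions; it is applicable to $f$ iff each contraction in turn is applicable to the result of the preceding ones. Sign. For $f:\omega\to\omega$, $\sigma(f)=0$ if $f(0)$ is odd and $\sigma(f)=1$ if $f(0)$ is even. Auxiliary functions. $h:\omega\to\omega$ is a primary auxiliary function ($h\in A_p$) if $h(k)<\vartheta(k-1)$ for all $k\ge2$ and for every $N\in\omega_+$ there is $M\ge N+1$ with $h(M)\ne\vartheta(M-1)-1$. It is a secondary auxiliary function ($h\in A_s$) if $h(k)<\vartheta(k-1)$ for all $k\ge2$ and there is $N\in\omega_+$ with $h(M)=\vartheta(M-1)-1$ for all $M\ge N+1$; the least such $N$ is $N^h_{\min}$. Base set. $W_1$ is the set of pairs $(h_p,h_s)\in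 A_p\times A_s$ such that, with $N=N^{h_s}_{\min}$, $h_p(k)=h_s(k)$ for $k<N$, $h_p(N)=h_s(N)+1$, and $h_p(k)=0$ for $k>N$. Two pairs in $W_1$ are equivalent if their first components agree on $\omega_+$ and have the same sign; $F$ is the collection of sets obtained by taking, for each equivalence class, the set of all functions that are components of its pairs. $W_2$ is the set of primary auxiliary functions occurring in no pair of $W_1$; two elements of $W_2$ are equivalent if they agree on $\omega_+$ and have the same sign; $G_2$ is the set of equivalence classes. The base set is $B=F\cup G_2$. Real numbers. For $b\in B$, $r_b$ is the set of $f:\omega\to\omega$ for which there is $h\in b$ such that for every $N\in\omega_+$ some sequence of contractions $\mathcal{C}$ applicable to $f$ satisfies $\mathcal{C}(f)(n)=h(n)$ for all $n\in[0,N]_\omega$. Let $b_1,b_2\in B$ be the elements containing respectively the zero function, and the function with value $1$ at $0$ and $0$ elsewhere. $\mathcal{S}_{\mathbb{R}}$ (the set of real numbers) consists of all $r_b$ with $b\in B\setminus\{b_1,b_2\}$ together with $[0]:=r_{b_1}\cup r_{b_2}$. Put $\mathcal{S}_{\mathbb{R}}^*=\mathcal{S}_{\mathbb{R}}\setminus\{[0]\}$. Distinct real numbers are disjoint. A function lying in some real number is called finite, and $[f]$ denotes the real number containing $f$. For $[a]\in\mathcal{S}_{\mathbb{R}}^*$ all elements have the same sign, denoted $\sigma([a])$. Order. For $[a],[b]\in\mathcal{S}_{\mathbb{R}}^*$, $[a]\le[b]$ iff one of the following holds: (i) $\sigma([a])<\sigma([b])$; (ii) $\sigma([a])=\sigma([b])=1$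 and for every $a\in[a]$ there is $b\in[b]$ with $a(n)\le b(n)$ for all $n\in\omega_+$; (iii) $\sigma([a])=\sigma([b])=0$ and for every $b\in[b]$ there is $a\in[a]$ with $a(n)\ge b(n)$ for all $n\in\omega_+$. For $[a]\in\mathcal{S}_{\mathbb{R}}^*$, $[a]\le[0]$ iff $\sigma([a])=0$, and $[0]\le[a]$ iff $\sigma([a])=1$. Finally $[0]\le[0]$ holds. *)

(* Defs.v *)
From mathcomp Require Import all_boot.
From mathcomp Require Import boolp classical_sets.

Set Implicit Arguments.
Unset Strict Implicit.
Unset Printing Implicit Defensive.

Local Open Scope classical_set_scope.

(* The system function is a map theta : nat -> nat; its value at 0 is never
   used. Value 0 of a function f : nat -> nat carries the sign; the entries at
   positive indices are the digits. *)
Definition system_function (theta : nat -> nat) : Prop :=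
  forall n, 0 < n -> 2 <= theta n.

Definition contraction_applicable (theta : nat -> nat) (n : nat)
    (f : nat -> nat) : Prop :=
  0 < n /\ theta n <= f n.+1.

(* Only meaningful when c_n is applicable to f, in which case the truncated
   subtraction is the genuine one. *)
Definition contraction (theta : nat -> nat) (n : nat) (f : nat -> nat) :
    nat -> nat :=
  fun k => if k == n then f n + 1
           else if k == n.+1 then f n.+1 - theta n
           else f k.

(* A sequence of contractions is the list of its indices, the head of the list
   being the contraction performed first. *)
Fixpoint contractions_applicable (theta : nat -> nat) (s : seq nat)
    (f : nat -> nat) : Prop :=
  if s is n :: s' then
    contraction_applicable theta n f /\
    contractions_applicable theta s' (contraction theta n f)
  else True.

Definition contractions (theta : nat -> nat) (s : seq nat) (f : nat -> nat) :
    nat -> nat :=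
  foldl (fun g n => contraction theta n g) f s.

Definition sigma (f : nat -> nat) : nat := if odd (f 0) then 0 else 1.

Definition agree_pos (f g : nat -> nat) : Prop := forall n, 0 < n -> f n = g n.

Definition digits_bounded (theta h : nat -> nat) : Prop :=
  forall k, 2 <= k -> h k < theta k.-1.

Definition maximal_after (theta h : nat -> nat) (N : nat) : Prop :=
  forall M, N.+1 <= M -> h M = (theta M.-1).-1.

Definition primary_aux (theta : nat -> nat) : set (nat -> nat) :=
  [set h | digits_bounded theta h /\
    forall N, 0 < N -> exists2 M, N.+1 <= M & h M <> (theta M.-1).-1].

Definition secondary_aux (theta : nat -> nat) : set (nat -> nat) :=
  [set h | digits_bounded theta h /\
    exists2 N, 0 < N & maximal_after theta h N].

Definition is_Nmin (theta h : nat -> nat) (N : nat) : Prop :=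
  [/\ 0 < N, maximal_after theta h N &
      forall N', 0 < N' -> maximal_after theta h N' -> N <= N'].

Definition W1 (theta : nat -> nat) : set ((nat -> nat) * (nat -> nat)) :=
  [set p | [/\ primary_aux theta p.1, secondary_aux theta p.2 &
    exists N, [/\ is_Nmin theta p.2 N,
                  forall k, k < N -> p.1 k = p.2 k,
                  p.1 N = p.2 N + 1 &
                  forall k, N < k -> p.1 k = 0]]].

Definition aux_equiv (f g : nat -> nat) : Prop :=
  agree_pos f g /\ sigma f = sigma g.

Definition base_F (theta : nat -> nat) : set (set (nat -> nat)) :=
  [set b | exists2 p, W1 theta p &
    b = [set f | exists q, [/\ W1 theta q, aux_equiv p.1 q.1 &
                               f = q.1 \/ f = q.2]]].

Definition W2 (theta : nat -> nat) : set (nat -> nat) :=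
  [set h | primary_aux theta h /\
    ~ exists2 p, W1 theta p & h = p.1 \/ h = p.2].

Definition base_G2 (theta : nat -> nat) : set (set (nat -> nat)) :=
  [set b | exists2 h, W2 theta h &
    b = [set g | W2 theta g /\ aux_equiv h g]].

Definition base_set (theta : nat -> nat) : set (set (nat -> nat)) :=
  base_F theta `|` base_G2 theta.

Definition r_of (theta : nat -> nat) (b : set (nat -> nat)) :
    set (nat -> nat) :=
  [set f | exists2 h, b h &
    forall N, 0 < N -> exists s, contractions_applicable theta s f /\
      forall n, n <= N -> contractions theta s f n = h n].

(* [xget] selects the element of the base set containing the given function;
   the elements of the base set are pairwise disjoint, so it is unique. *)
Definition base_elt_of (theta h : nat -> nat) : set (nat -> nat) :=
  xget set0 [set b | base_set theta b /\ b h].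

Definition b1 (theta : nat -> nat) : set (nat -> nat) :=
  base_elt_of theta (fun=> 0).

Definition b2 (theta : nat -> nat) : set (nat -> nat) :=
  base_elt_of theta (fun n => if n == 0 then 1 else 0).

Definition real_zero (theta : nat -> nat) : set (nat -> nat) :=
  r_of theta (b1 theta) `|` r_of theta (b2 theta).

Definition reals (theta : nat -> nat) : set (set (nat -> nat)) :=
  [set x | (exists b, [/\ base_set theta b, b <> b1 theta, b <> b2 theta &
                          x = r_of theta b])
           \/ x = real_zero theta].

Definition reals_star (theta : nat -> nat) : set (set (nat -> nat)) :=
  reals theta `\ real_zero theta.

(* All elements of a nonzero real number have the same sign, so the sign of the
   element picked by [xget] is the common one. *)
Definition real_sigma (x : set (nat -> nat)) : nat :=
  sigma (xget (fun=> 0) x).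

Definition real_le_star (x y : set (nat -> nat)) : Prop :=
  [\/ real_sigma x < real_sigma y,
      [/\ real_sigma x = 1, real_sigma y = 1 &
          forall a, x a -> exists2 b, y b & forall n, 0 < n -> a n <= b n] |
      [/\ real_sigma x = 0, real_sigma y = 0 &
          forall b, y b -> exists2 a, x a & forall n, 0 < n -> a n >= b n]].

Definition real_le (theta : nat -> nat) (x y : set (nat -> nat)) : Prop :=
  [\/ [/\ reals_star theta x, reals_star theta y & real_le_star x y],
      [/\ reals_star theta x, y = real_zero theta & real_sigma x = 0],
      [/\ x = real_zero theta, reals_star theta y & real_sigma y = 1] |
      x = real_zero theta /\ y = real_zero theta].

Definition is_upper_bound (theta : nat -> nat) (S : set (set (nat -> nat)))
    (u : set (nat -> nat)) : Prop :=
  reals theta u /\ forall x, S x -> real_le theta x u.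

Definition is_least_upper_bound (theta : nat -> nat)
    (S : set (set (nat -> nat))) (l : set (nat -> nat)) : Prop :=
  is_upper_bound theta S l /\
  forall u, is_upper_bound theta S u -> real_le theta l u.

(* Main.v *)
(** Contractions preserve the value f(1) + f(2)/theta(1) + f(3)/(theta(1)theta(2)) + ...,
    so they act as carries in a mixed radix system.  A function contracts to
    every initial segment of some element of a class of the base set exactly
    when it has the sign and the value of that class: carrying out all digits up
    to M computes the digits of the M-th partial sum, and these stabilise as M
    grows.  For a terminating value they stabilise to the terminating expansion
    if the partial sums attain the value, and to the non-terminating one
    otherwise, which is why the elements of F contain both.  Hence the real
    numbers are the fibres of the signed value; greedy digits show that every
    real is taken, and adding an expansion of the difference of two values shows
    that the order is the usual one.  Completeness is then inherited. *)

Require Import Defs.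
From mathcomp Require Import all_boot all_order all_algebra.
From mathcomp Require Import boolp classical_sets reals Rstruct.
From mathcomp Require Import zify lra.

Import Order.TTheory GRing.Theory Num.Theory.

Local Open Scope classical_set_scope.

Section Positional.

Context (theta : nat -> nat) (htheta : system_function theta).

(** * Contractions and integer partial sums *)

Fixpoint weight (k : nat) : nat :=
  if k is k'.+1 then theta k * weight k' else 1.

(** Horner's scheme: this is [weight k] times the sum of the first [k.+1] terms of the mixed radix
    series, kept as an integer. *)
Fixpoint scaled (f : nat -> nat) (k : nat) : nat :=
  if k is k'.+1 then theta k * scaled f k' + f k.+1 else f 1.

Lemma weight_gt0 k : 0 < weight k.
Proof. by elim: k => //= k IH; rewrite muln_gt0 IH andbT; have := htheta k.+1 isT; lia. Qed.

Lemma ltn_weight k : k < weight k.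
Proof.
elim: k => //= k IH; have := htheta k.+1 isT => h2.
by apply: (@leq_trans (2 * weight k)); [lia | rewrite leq_mul2r h2 orbT].
Qed.

Lemma eq_scaled f g k : agree_pos f g -> scaled f k = scaled g k.
Proof. by move=> fg; elim: k => [|k IH] /=; rewrite ?IH fg. Qed.

(** A carry trades [theta n] units at position [n.+1] for one unit at [n], which is worth the same.
    Only the truncation ending at position [n], that is [n = k.+1], sees the gain without the
    loss. *)
Lemma scaled_contraction n f k : contraction_applicable theta n f ->
  scaled (contraction theta n f) k = scaled f k + (n == k.+1).
Proof.
case=> n0 app; elim: k => [|k IH]; rewrite /= ?IH /contraction.
  by case: n n0 app => [|[|n]] //= _ _; rewrite ?addn0.
have [nk|n1] := eqVneq n k.+1.
  subst n; rewrite eqxx ifF; last by lia.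
  by rewrite (_ : (k.+1 == k.+2) = false); lia.
rewrite addn0 eq_sym.
have [->|n2] := eqVneq n k.+2; first by rewrite addnA.
by rewrite (_ : (k.+2 == n.+1) = false) ?addn0 //; lia.
Qed.

Lemma scaled_contractions s f k : contractions_applicable theta s f ->
  scaled (contractions theta s f) k = scaled f k + count_mem k.+1 s.
Proof.
elim: s f => [|n s IH] f /=; first by rewrite addn0.
by case=> an as_; rewrite IH // scaled_contraction // addnA.
Qed.

(** [c_n] touches only positions [n] and [n.+1]; the hypothesis keeps [m] away from both. *)
Lemma contractions_out s f m : contractions_applicable theta s f ->
  (forall n, n \in s -> n < m.-1 \/ m < n) -> contractions theta s f m = f m.
Proof.
elim: s f => [|n s IH] f //= [[n0 _] as_] sm.
rewrite IH // => [|i si]; last by apply: sm; rewrite inE si orbT.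
have := sm n; rewrite inE eqxx => /(_ isT) nm.
by rewrite /contraction !ifF //; lia.
Qed.

Lemma contractions_at0 s f : contractions_applicable theta s f ->
  contractions theta s f 0 = f 0.
Proof.
elim: s f => [|n s IH] f //= [[n0 _] as_].
by rewrite IH // /contraction; case: n n0 {as_}.
Qed.

Lemma contractions_applicable_cat s t f :
  contractions_applicable theta (s ++ t) f <->
  contractions_applicable theta s f /\
  contractions_applicable theta t (contractions theta s f).
Proof.
elim: s f => [|n s IH] f /=; first by split=> [|[]].
by rewrite IH; split=> [[? []]|[[]]].
Qed.

Lemma contractions_cat s t f :
  contractions theta (s ++ t) f = contractions theta t (contractions theta s f).
Proof. exact: foldl_cat. Qed.

(** * Normalising digits by carrying *)

Lemma bound_digit n f : 0 < n -> exists s,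
  [/\ contractions_applicable theta s f, all (pred1 n) s &
      contractions theta s f n.+1 < theta n].
Proof.
move=> n0; have t2 := htheta n n0.
(* Induction on a bound for the digit, with [f] generalised because every contraction replaces
   it. *)
elim: {f}(f n.+1) {-2}f (leqnn (f n.+1)) => [|m IH] f fm.
  by exists [::]; split=> //=; lia.
have [ft|ft] := ltnP (f n.+1) (theta n); first by exists [::].
have [|s [as_ sn st]] := IH (contraction theta n f).
  by rewrite /contraction eqxx ifF; lia.
by exists (n :: s); split=> //=; rewrite eqxx.
Qed.

(** Carries start at the highest position: those with index at most [M] never disturb position
    [M.+2], which has been reduced already. *)
Lemma bound_digits M f : exists s,
  [/\ contractions_applicable theta s f, all (fun n => 0 < n <= M) s &
      forall n, 0 < n <= M -> contractions theta s f n.+1 < theta n].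
Proof.
elim: M f => [|M IH] f; first by exists [::]; split=> // n; lia.
have [s [as_ sM sb]] := bound_digit M.+1 f isT.
have [t [at_ tM tb]] := IH (contractions theta s f).
exists (s ++ t); split.
- exact/contractions_applicable_cat.
- rewrite all_cat; apply/andP; split.
    by apply: sub_all sM => i /eqP ->; rewrite /= leqnn.
  by apply: sub_all tM => i /andP[i0 iM]; rewrite i0 (leqW iM).
- move=> n /andP[n0]; rewrite leq_eqVlt contractions_cat => /orP[/eqP ->|nM].
    rewrite contractions_out // => i /(allP tM) /andP[_ iM]; left; lia.
  by apply: tb; rewrite n0.
Qed.


(** * Real partial sums and their error bounds *)

Context {R : realType}.

Local Notation ulp k := ((weight k)%:R^-1 : R)%R.

(* The partial sums are indexed from 0: [psum f k] involves the digits f 1, ..., f k.+1. *)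
Definition psum (f : nat -> nat) (k : nat) : R := ((scaled f k)%:R * ulp k)%R.

Lemma ulp_gt0 k : (0 < ulp k)%R.
Proof. rewrite invr_gt0 ltr0n; exact: weight_gt0. Qed.

Lemma ulpS k : ulp k = ((theta k.+1)%:R * ulp k.+1)%R.
Proof.
rewrite /= natrM invfM mulrA mulfV ?mul1r // pnatr_eq0.
by have := htheta k.+1 isT; lia.
Qed.

Lemma psumS f k : psum f k.+1 = (psum f k + (f k.+2)%:R * ulp k.+1)%R.
Proof. by rewrite [in RHS]/psum ulpS mulrA -mulrDl -natrM -natrD mulnC. Qed.

Lemma eq_psum f g k : agree_pos f g -> psum f k = psum g k.
Proof. by move=> fg; rewrite /psum (eq_scaled _ _ _ fg). Qed.

Lemma psum_homo f i j : i <= j -> (psum f i <= psum f j)%R.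
Proof.
elim: j => [|j IH]; first by rewrite leqn0 => /eqP ->.
rewrite leq_eqVlt => /orP[/eqP -> //|/IH ij]; apply: le_trans ij _.
by rewrite psumS lerDl mulr_ge0 // ltW // ulp_gt0.
Qed.

Lemma psum_ge0 f k : (0 <= psum f k)%R.
Proof. by rewrite mulr_ge0 // ltW // ulp_gt0. Qed.

Lemma psumD f g k : psum (fun n => f n + g n) k = (psum f k + psum g k)%R.
Proof.
elim: k => [|k IH]; first by rewrite /psum /= natrD mulrDl.
by rewrite !psumS IH natrD mulrDl addrACA.
Qed.

Lemma ler_psum f g k : (forall n, 0 < n -> f n <= g n) -> (psum f k <= psum g k)%R.
Proof.
move=> fg; elim: k => [|k IH].
  by rewrite ler_pM2r ?ulp_gt0 // ler_nat; exact: fg.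
by rewrite !psumS lerD // ler_pM2r ?ulp_gt0 // ler_nat fg.
Qed.

(** With bounded digits, the intervals from [psum f k] to [psum f k + ulp k] are nested; a maximal
    digit keeps the upper end fixed. *)
Lemma psum_top_lt f k : f k.+2 < theta k.+1 ->
  (psum f k.+1 + ulp k.+1 <= psum f k + ulp k)%R.
Proof.
move=> ft; rewrite psumS (ulpS k) -addrA lerD2l -{2}[ulp k.+1]mul1r -mulrDl.
by rewrite ler_pM2r ?ulp_gt0 // natr1 ler_nat.
Qed.

Lemma psum_top_max f k : f k.+2 = (theta k.+1).-1 ->
  (psum f k.+1 + ulp k.+1 = psum f k + ulp k)%R.
Proof.
move=> ft; rewrite psumS (ulpS k) -addrA -{2}[ulp k.+1]mul1r -mulrDl natr1 ft prednK //.
exact: leq_trans (htheta k.+1 isT).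
Qed.

Lemma psum_top_homo f M i j : (forall n, 0 < n <= M -> f n.+1 < theta n) ->
  i <= j <= M -> (psum f j + ulp j <= psum f i + ulp i)%R.
Proof.
move=> fb /andP[]; elim: j => [|j IH]; first by rewrite leqn0 => /eqP ->.
rewrite leq_eqVlt => /orP[/eqP -> //|ij] jM.
by apply: le_trans (IH _ _); rewrite ?(ltnW jM) //; apply/psum_top_lt/fb; rewrite ltn0Sn.
Qed.

(** The units tend to 0, since [weight k] exceeds [k] and the field is archimedean. *)
Lemma ler_ulp (a b : R) N : (forall k, N <= k -> (a <= b + ulp k)%R) -> (a <= b)%R.
Proof.
move=> ab; rewrite leNgt; apply/negP => ba.
have d0 : (0 < a - b)%R by rewrite subr_gt0.
pose k := maxn N (Num.truncn (a - b)^-1%R).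
have := ab k (leq_maxl _ _); apply/negP; rewrite -ltNge.
suff : (ulp k < a - b)%R by lra.
rewrite -[ltRHS]invrK ltf_pV2 ?posrE ?invr_gt0 ?ltr0n ?weight_gt0 //.
apply: lt_le_trans (truncnS_gt _) _; rewrite ler_nat.
exact: leq_ltn_trans (leq_maxr _ _) (ltn_weight _).
Qed.

(** * Values as suprema of partial sums *)

(** A relation rather than a function, because the partial sums of an arbitrary [f] may be
    unbounded. *)
Definition value_is (f : nat -> nat) (x : R) : Prop :=
  (forall k, (psum f k <= x)%R) /\
  (forall y, (forall k, (psum f k <= y)%R) -> (x <= y)%R).

Lemma value_unique f x y : value_is f x -> value_is f y -> x = y.
Proof. by move=> [fx xf] [fy yf]; apply/eqP; rewrite eq_le xf // yf. Qed.

Lemma eq_value f g x : agree_pos f g -> value_is f x -> value_is g x.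
Proof.
move=> fg [fx xf]; split=> [k|y gy]; first by rewrite -(eq_psum _ _ _ fg).
by apply: xf => k; rewrite (eq_psum _ _ _ fg).
Qed.

Lemma value_ge0 f x : value_is f x -> (0 <= x)%R.
Proof. by case=> fx _; apply: le_trans (fx 0); exact: psum_ge0. Qed.

Lemma value_homo f g x y : (forall n, 0 < n -> f n <= g n) ->
  value_is f x -> value_is g y -> (x <= y)%R.
Proof. by move=> fg [_ xf] [gy _]; apply: xf => k; apply: le_trans (gy k); exact: ler_psum. Qed.

Lemma value_add f g x y : value_is f x -> value_is g y ->
  value_is (fun n => f n + g n) (x + y)%R.
Proof.
move=> [fx xf] [gy yg]; split=> [k|z fgz]; first by rewrite psumD lerD.
rewrite -lerBrDr; apply: xf => i; rewrite lerBrDl -lerBrDr; apply: yg => j.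
rewrite lerBrDr addrC; apply: le_trans (fgz (maxn i j)).
by rewrite psumD lerD // psum_homo // ?leq_maxl ?leq_maxr.
Qed.

Lemma value_ex f b : (forall k, (psum f k <= b)%R) -> exists x, value_is f x.
Proof.
move=> fb; pose E : set R := [set psum f k | k in setT].
have E0 : E !=set0 by exists (psum f 0), 0.
exists (sup E); split=> [k|y fy].
  by apply: ub_le_sup; [exists b => _ [i _ <-] | exists k].
by apply: ge_sup => // _ [i _ <-].
Qed.

Lemma value_0P f : value_is f 0%R <-> forall n, 0 < n -> f n = 0.
Proof.
split=> [[f0 _] n n0|f0].
  suff scn k : scaled f k = 0.
    case: n n0 => [|[|n]] // _; first exact: scn 0.
    by have /= := scn n.+1; lia.
  move/(_ k): f0; rewrite /psum pmulr_lle0 ?ulp_gt0 // -[0%R]/(0%:R)%R ler_nat.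
  by rewrite leqn0 => /eqP.
have ps k : psum f k = 0%R.
  elim: k => [|k IH]; first by rewrite /psum /= f0 // mul0r.
  by rewrite psumS IH f0 // mul0r addr0.
by split=> [k|y /(_ 0)]; rewrite ps.
Qed.

(** * Contractions preserve values, and values determine the reachable digits *)

Lemma psum_contractions s f k : contractions_applicable theta s f ->
  (psum f k <= psum (contractions theta s f) k)%R.
Proof.
by move=> as_; rewrite ler_pM2r ?ulp_gt0 // ler_nat scaled_contractions // leq_addr.
Qed.

Lemma value_contractions s f x : contractions_applicable theta s f ->
  value_is f x -> forall k, (psum (contractions theta s f) k <= x)%R.
Proof.
(* Past the largest index occurring in [s], the partial sums of [f] and of its contraction
   coincide. *)
move=> as_ [fx _] k; pose m := maxn k (\max_(i <- s) i).
apply: (le_trans (psum_homo _ k m (leq_maxl _ _))); apply: le_trans (fx m).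
rewrite /psum scaled_contractions // (count_memPn _) ?addn0 //.
apply/negP => ms; have := @leq_bigmax_seq _ s xpredT id _ ms isT.
by rewrite leqNgt ltnS leq_maxr.
Qed.

(** Each partial sum of [h] is also one of a contraction of [f], so it lies between the partial sum
    of [f] and any value of [f]. *)
Lemma approximable_value f h x :
  (forall N, 0 < N -> exists s, contractions_applicable theta s f /\
     forall n, n <= N -> contractions theta s f n = h n) ->
  value_is h x -> value_is f x.
Proof.
move=> fh [hx xh].
have psum_eq k : exists2 s, contractions_applicable theta s f &
    psum (contractions theta s f) k = psum h k.
  have [s [as_ sh]] := fh k.+1 isT; exists s => //; rewrite /psum; congr (_%:R * _)%R.
  suff sc i : i <= k -> scaled (contractions theta s f) i = scaled h i by exact: sc.
  by elim: i => [|i IH] ik /=; rewrite ?sh ?IH //; lia.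
have fx k : (psum f k <= x)%R.
  by apply: le_trans (hx k); have [s as_ <-] := psum_eq k; exact: psum_contractions.
have [y fy] := value_ex _ _ fx.
suff -> : x = y by [].
apply/eqP; rewrite eq_le fy.2 // andbT; apply: xh => k.
by have [s as_ <-] := psum_eq k; exact: value_contractions.
Qed.

(** Both sums are integer multiples of [ulp k], so a difference below one unit cannot be
    positive. *)
Lemma psum_lt_scaled_le f g k : (psum f k < psum g k + ulp k)%R -> scaled f k <= scaled g k.
Proof.
rewrite /psum -{3}[ulp k]mul1r -mulrDl ltr_pM2r ?ulp_gt0 // natr1 ltr_nat.
by rewrite ltnS.
Qed.

Lemma digits_boundedS h n : digits_bounded theta h -> 0 < n -> h n.+1 < theta n.
Proof. by move=> hb n0; exact: (hb n.+1). Qed.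

(** Carrying with indices up to [M] leaves [psum f M] unchanged. For [k <= N] the truncations of the
    result and of [h] then differ by less than one unit, hence agree, and the digits are read off
    from them. *)
Lemma reduce_to h f N M : digits_bounded theta h -> f 0 = h 0 -> N <= M ->
  (psum h N <= psum f M < psum h N + ulp N)%R ->
  exists s, contractions_applicable theta s f /\
    forall n, n <= N.+1 -> contractions theta s f n = h n.
Proof.
move=> hb f0 NM /andP[hf fh].
have [s [as_ sM sb]] := bound_digits M f.
exists s; split=> //; set g := contractions theta s f in sb *.
have gM : psum g M = psum f M.
  rewrite /psum scaled_contractions // (count_memPn _) ?addn0 //.
  by apply/negP => /(allP sM); rewrite ltnn andbF.
have sgh k : k <= N -> scaled g k = scaled h k.
  move=> kN; have kM := leq_trans kN NM.
  apply/eqP; rewrite eqn_leq; apply/andP; split; apply: psum_lt_scaled_le.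
    apply: le_lt_trans (psum_homo g _ _ kM) _; rewrite gM.
    apply: lt_le_trans fh _; apply: (psum_top_homo h N); last by rewrite kN leqnn.
    by move=> n /andP[n0 _]; exact: digits_boundedS.
  apply: le_lt_trans (psum_homo h _ _ kN) _; apply: le_lt_trans hf _; rewrite -gM.
  have := psum_top_homo g M k M sb; rewrite kM leqnn => /(_ isT).
  by have := ulp_gt0 M; lra.
case=> [|[|n]] nN; first by rewrite /g contractions_at0.
  exact: (sgh 0).
by have := sgh n.+1 nN; rewrite /= (sgh n (ltnW nN)) => /addnI.
Qed.

Lemma value_top h x k : digits_bounded theta h -> value_is h x ->
  (x <= psum h k + ulp k)%R.
Proof.
move=> hb [_]; apply=> j; apply: le_trans (psum_homo h _ _ (leq_maxl j k)) _.
have := psum_top_homo h (maxn j k) k (maxn j k).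
rewrite leq_maxr leqnn => /(_ _ isT) H.
apply: le_trans (H _); first by rewrite lerDl ltW // ulp_gt0.
by move=> n /andP[n0 _]; exact: digits_boundedS.
Qed.

(** A primary function has a non-maximal digit arbitrarily far out, where the nested intervals
    shrink strictly at the top. *)
Lemma value_top_lt h x k : primary_aux theta h -> value_is h x ->
  (x < psum h k + ulp k)%R.
Proof.
move=> [hb /(_ k.+1 isT) [[|[|m]] // km hm]] hx.
apply: le_lt_trans (value_top h x m.+1 hb hx) _.
have mlt : (psum h m.+1 + ulp m.+1 < psum h m + ulp m)%R.
  rewrite psumS (ulpS m) -addrA ltrD2l -{2}[ulp m.+1]mul1r -mulrDl.
  rewrite ltr_pM2r ?ulp_gt0 // natr1 ltr_nat.
  by have := digits_boundedS h m.+1 hb isT; move: hm => /=; lia.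
apply: lt_le_trans mlt _; apply: (psum_top_homo h m); last by rewrite leqnn; lia.
by move=> n /andP[n0 _]; exact: digits_boundedS.
Qed.

Lemma digits_bounded_value h : digits_bounded theta h -> exists x, value_is h x.
Proof.
move=> hb; apply: (value_ex h (psum h 0 + ulp 0)%R) => k.
have := psum_top_homo h k 0 k; rewrite leqnn /= => /(_ _ isT) H.
apply: le_trans (H _); first by rewrite lerDl ltW // ulp_gt0.
by move=> n /andP[n0 _]; exact: digits_boundedS.
Qed.

(** For a value [x] of [f], this says that the expansion terminates. *)
Definition attains (f : nat -> nat) (x : R) : Prop := exists M, psum f M = x.

Lemma attains_ge f x M k : value_is f x -> psum f M = x -> M <= k -> psum f k = x.
Proof.
by move=> [fx _] fM Mk; apply/eqP; rewrite eq_le fx -fM psum_homo.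
Qed.

(** [reduce_to] needs a partial sum of [f] in a half-open interval. The [strict] hypothesis keeps it
    below the open upper end; the last hypothesis lets it reach [psum h N]. *)
Lemma value_approximable h f x : digits_bounded theta h ->
  value_is h x -> value_is f x -> f 0 = h 0 ->
  primary_aux theta h \/ ~ attains f x -> (attains h x -> attains f x) ->
  forall N, 0 < N -> exists s, contractions_applicable theta s f /\
    forall n, n <= N -> contractions theta s f n = h n.
Proof.
move=> hb hx fx f0 strict att [//|N] _.
have hi M : (psum f M < psum h N + ulp N)%R.
  case: strict => [hp|nf].
    exact: le_lt_trans (fx.1 M) (value_top_lt h x N hp hx).
  apply: lt_le_trans (value_top h x N hb hx).
  by rewrite lt_neqAle fx.1 andbT; apply/eqP => fM; apply: nf; exists M.
suff [M hM] : exists M, (psum h N <= psum f M)%R.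
  apply: (reduce_to h f N (maxn N M)) => //; first exact: leq_maxl.
  by rewrite hi andbT; apply: le_trans hM (psum_homo _ _ _ _); exact: leq_maxr.
have [[M fM]|nf] := pselect (attains f x); first by exists M; rewrite fM hx.1.
have hN : (psum h N < x)%R.
  by rewrite lt_neqAle hx.1 andbT; apply/eqP => hN; apply/nf/att; exists N.
(* If no partial sum of [f] reached [psum h N], that number would be an upper bound below the
   supremum [x]. *)
apply: contrapT => no; move: hN; apply/negP; rewrite -leNgt; apply: fx.2 => k.
by rewrite leNgt; apply/negP => /ltW hk; apply: no; exists k.
Qed.

(** * Greedy expansions *)

Lemma value_sandwich f x n :
  (forall k, n <= k -> (psum f k <= x <= psum f k + ulp k)%R) -> value_is f x.
Proof.
move=> fx; split=> [k|y fy].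
  apply: le_trans (psum_homo f _ _ (leq_maxl k n)) _.
  by have /andP[] := fx (maxn k n) (leq_maxr _ _).
apply: (ler_ulp _ _ n) => k /fx /andP[_ /le_trans]; apply.
by rewrite lerD2r.
Qed.

(** [t k] is the integer part of [x * weight k]; the digits are chosen so that [scaled h k] equals
    [t k]. *)
Lemma expansion_ex (x : R) a : (0 <= x)%R ->
  exists h, [/\ primary_aux theta h, h 0 = a & value_is h x].
Proof.
move=> x0; pose t k := Num.truncn (x * (weight k)%:R).
pose h n := if n is n'.+1 then
  (if n' is k.+1 then t k.+1 - theta k.+1 * t k else t 0) else a.
have tP k : ((t k)%:R <= x * (weight k)%:R < (t k).+1%:R)%R.
  by apply: truncn_itv; rewrite mulr_ge0.
have tle k : theta k.+1 * t k <= t k.+1.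
  rewrite truncn_ge_nat ?mulr_ge0 // !natrM mulrCA ler_wpM2l //.
  by have /andP[] := tP k.
have tlt k : t k.+1 < theta k.+1 * (t k).+1.
  rewrite truncn_lt_nat ?mulr_ge0 // !natrM mulrCA ltr_pM2l.
    by have /andP[] := tP k.
  by rewrite ltr0n; have := htheta k.+1 isT; lia.
have sh k : scaled h k = t k.
  by elim: k => [|k IH] //=; rewrite IH subnKC.
have itv k : (psum h k <= x < psum h k + ulp k)%R.
  rewrite /psum sh -{3}[ulp k]mul1r -mulrDl natr1.
  by rewrite ler_pdivrMr ?ltr_pdivlMr ?ltr0n ?weight_gt0.
have hb : digits_bounded theta h.
  case=> [|[|k]] // _ /=; have := tlt k; have := tle k.
  by rewrite mulnS; lia.
exists h; split=> //; last first.
  by apply: (value_sandwich _ _ 0) => k _; have /andP[-> /ltW ->] := itv k.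
(* If all later digits were maximal, the upper end [psum h k + ulp k] would stay constant and [x]
   would reach it, against the strict half of [itv]. *)
split=> // -[//|n] _; apply: contrapT => no.
have hmax k : n <= k -> h k.+2 = (theta k.+1).-1.
  by move=> nk; apply: contrapT => hk; apply: no; exists k.+2.
have top k : n <= k -> (psum h k + ulp k = psum h n + ulp n)%R.
  elim: k => [|k IH]; first by rewrite leqn0 => /eqP ->.
  rewrite leq_eqVlt => /orP[/eqP <- //|nk].
  by rewrite psum_top_max ?IH // hmax.
have : (psum h n + ulp n <= x)%R.
  apply: (ler_ulp _ _ n) => k nk; rewrite -(top k nk) lerD2r.
  by have /andP[] := itv k.
by apply/negP; rewrite -ltNge; have /andP[] := itv n.
Qed.

(** * Values of the classes of the base set *)

(** With [n.+1] the critical index, from [n] on the sums of the first component are constant, while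
    those of the second stay exactly one unit [ulp k] below that constant. *)
Lemma W1_value q : W1 theta q -> exists2 x : R, (0 < x)%R &
  [/\ value_is q.1 x, value_is q.2 x, attains q.1 x & ~ attains q.2 x].
Proof.
case: q => p s [/= _ _ [[|n] [[//= _ smax _] pk pn p0]]].
have tail k : n <= k -> psum p k = psum p n /\ (psum s k + ulp k = psum p n)%R.
  elim: k => [|k IH].
    rewrite leqn0 => /eqP n0; move: pn; rewrite n0 => pn; split=> //.
    by rewrite /psum -{2}[ulp 0]mul1r -mulrDl natr1 /= pn addn1.
  rewrite leq_eqVlt => /orP[/eqP nk|nk]; last first.
    have [pk' sk'] := IH nk; split.
      by rewrite psumS pk' p0 ?mul0r ?addr0 //; lia.
    by rewrite psum_top_max ?sk' // smax.
  subst n; split=> //.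
  have sc i : i <= k -> scaled p i = scaled s i.
    by elim: i => [|i IHi] ik /=; rewrite pk ?IHi //; lia.
  rewrite !psumS pn natrD mulrDl mul1r /psum sc // -addrA; congr (_ + _)%R.
exists (psum p n).
  by have [_ <-] := tail n (leqnn n); rewrite ltr_wpDl ?psum_ge0 ?ulp_gt0.
split.
- by apply: (value_sandwich _ _ n) => k /tail [-> _]; rewrite lexx lerDl ltW ?ulp_gt0.
- by apply: (value_sandwich _ _ n) => k /tail [_ <-]; rewrite lexx lerDl ltW ?ulp_gt0.
- by exists n.
- case=> M sM; have /tail [_] := leq_maxl n M; rewrite -sM.
  have := psum_homo s _ _ (leq_maxr n M); have := ulp_gt0 (maxn n M); lra.
Qed.

Lemma W1_at0 q : W1 theta q -> q.1 0 = q.2 0.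
Proof. by case=> _ _ [N [[N0 _ _] pk _ _]]; exact: pk. Qed.

(** Equivalence fixes only the parity at 0, but contractions preserve the entry at 0 exactly; this
    moves between representatives. *)
Definition set_sign (f : nat -> nat) (a : nat) : nat -> nat :=
  fun n => if n is 0 then a else f n.

Lemma agree_set_sign f a : agree_pos f (set_sign f a).
Proof. by case. Qed.

Lemma agree_digits_bounded f g : agree_pos f g ->
  digits_bounded theta f -> digits_bounded theta g.
Proof. by move=> fg fb k k2; rewrite -fg; [exact: fb | lia]. Qed.

Lemma agree_primary f g : agree_pos f g -> primary_aux theta f -> primary_aux theta g.
Proof.
move=> fg [fb fp]; split; first exact: agree_digits_bounded fb.
by move=> N /fp [M NM fM]; exists M => //; rewrite -fg //; lia.
Qed.

Lemma agree_maximal_after f g N : agree_pos f g ->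
  maximal_after theta f N -> maximal_after theta g N.
Proof. by move=> fg fm M NM; rewrite -fg ?fm //; lia. Qed.

Lemma agree_posC f g : agree_pos f g -> agree_pos g f.
Proof. by move=> fg n n0; rewrite fg. Qed.

Lemma W1_set_sign q a : W1 theta q -> W1 theta (set_sign q.1 a, set_sign q.2 a).
Proof.
case=> q1 [q2 [M M0 mM]] [N [[N0 mN Nmin] pk pN p0]]; split=> /=.
- exact: agree_primary (agree_set_sign _ _) q1.
- split; first exact: agree_digits_bounded (agree_set_sign _ _) q2.
  by exists M => //; exact: agree_maximal_after (agree_set_sign _ _) mM.
- exists N; split.
  + split=> //; first exact: agree_maximal_after (agree_set_sign _ _) mN.
    move=> N' N'0 mN'; apply: Nmin => //.
    exact: agree_maximal_after (agree_posC _ _ (agree_set_sign _ a)) mN'.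
  + by case=> [//|k] kN /=; exact: pk.
  + by case: N N0 pN {mN Nmin pk p0}.
  + by case=> [//|k] Nk /=; exact: p0.
Qed.

(** Borrowing: lower the last nonzero digit by one and let maximal digits follow. *)
Lemma W1_of_last_digit h N : primary_aux theta h -> 0 < N -> h N <> 0 ->
  (forall k, N < k -> h k = 0) -> exists h', W1 theta (h, h').
Proof.
move=> hp N0 hN h0; have hb := hp.1.
pose h' n := if n < N then h n else if n == N then (h N).-1 else (theta n.-1).-1.
have h'max : maximal_after theta h' N.
  by move=> M NM; rewrite /h' ltnNge ltnW //= gtn_eqF.
exists h'; split=> //=.
- split; last by exists N.
  move=> k k2; rewrite /h'; have := htheta k.-1; have := hb k k2.
  by case: (ltngtP k N) => [//|//|<-] /=; lia.
- exists N; split.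
  + split=> // N' N'0 mN'; rewrite leqNgt; apply/negP => NN'.
    by have := mN' N NN'; rewrite /h' ltnn eqxx; have := hb N; lia.
  + by move=> k kN; rewrite /h' kN.
  + by rewrite /h' ltnn eqxx; lia.
  + exact: h0.
Qed.

Lemma attains_tail0 h x M : value_is h x -> psum h M = x ->
  forall k, M.+1 < k -> h k = 0.
Proof.
move=> hx hM [|[|k]] // Mk.
have hk : psum h k = x by apply: (attains_ge h x M).
have : psum h k.+1 = x by apply: (attains_ge h x M) => //; lia.
rewrite psumS hk => E; have : ((h k.+2)%:R * ulp k.+1 = 0 :> R)%R by lra.
by move=> /eqP; rewrite mulf_eq0 (gt_eqF (ulp_gt0 _)) orbF pnatr_eq0 => /eqP.
Qed.

Lemma attains_primary h x : primary_aux theta h -> value_is h x -> attains h x ->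
  x = 0%R \/ exists h', W1 theta (h, h').
Proof.
move=> hp hx [M hM]; have h0 := attains_tail0 h x M hx hM.
have [ex|nex] := pselect (exists n, (0 < n) && (h n != 0)); [right|left].
  have ub n : (0 < n) && (h n != 0) -> n <= M.+1.
    by case/andP=> _; apply: contraNleq => /h0 ->.
  case: (ex_maxnP ex ub) => N /andP[N0 /eqP hN] Nmax.
  apply: (W1_of_last_digit h N) => // k Nk; apply: contrapT => /eqP hk.
  by have := Nmax k; rewrite hk andbT; lia.
apply: (value_unique h) => //; apply/value_0P => n n0.
by apply: contrapT => /eqP hn; apply: nex; exists n; rewrite n0.
Qed.

Lemma odd_sigma f g : sigma f = sigma g <-> odd (f 0) = odd (g 0).
Proof. by rewrite /sigma; case: (odd (f 0)); case: (odd (g 0)). Qed.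

(** In a class of [base_F], the two components of a pair share their value and their entry at 0, so
    the equivalence of first components suffices. *)
Lemma base_elt_value b g h x : base_set theta b -> b g -> b h -> value_is g x ->
  value_is h x /\ odd (h 0) = odd (g 0).
Proof.
case=> [[p _ ->]|[p _ ->]]; last first.
  move=> [_ [pg /odd_sigma og]] [_ [ph /odd_sigma oh]] gx; split; last by rewrite -og.
  by apply: eq_value ph _; apply: eq_value gx; exact: agree_posC.
have comp q f y : W1 theta q -> f = q.1 \/ f = q.2 ->
    (value_is f y <-> value_is q.1 y) /\ odd (f 0) = odd (q.1 0).
  move=> wq; have [z _ [q1 q2 _ _]] := W1_value q wq.
  case=> ->; rewrite ?(W1_at0 q wq) //; split=> //.
  by split=> qy; [rewrite -(value_unique _ _ _ q2 qy)|rewrite -(value_unique _ _ _ q1 qy)].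
move=> [q [wq [pq /odd_sigma oq] fq]] [r [wr [pr /odd_sigma or_] fr]] gx.
have [gq ogq] := comp q g x wq fq; have [hr ohr] := comp r h x wr fr.
split; last by rewrite ohr ogq -oq.
apply/hr/(eq_value p.1) => //; apply: (eq_value q.1); first exact: agree_posC.
exact/gq.
Qed.

Lemma base_elt_nonempty b : base_set theta b ->
  exists h, b h /\ digits_bounded theta h.
Proof.
case=> [[p wp ->]|[p wp ->]].
  by exists p.1; split; [exists p; split=> //; left | case: wp => -[]].
by exists p; split=> //; case: wp => -[].
Qed.

Lemma base_elt_ex h : primary_aux theta h -> exists b, base_set theta b /\ b h.
Proof.
move=> hp; have [[q wq hq]|nw] := pselect (exists2 q, W1 theta q & h = q.1 \/ h = q.2).
  eexists; split; first by left; exists q.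
  by exists q.
eexists; split; first by right; exists h.
by split.
Qed.

(** The set attached to a class is a whole fibre of value and parity. For the harder inclusion, a
    representative [g] suited to [f] has to be found in the class. *)
Lemma r_of_value b h x : base_set theta b -> b h -> value_is h x ->
  r_of theta b = [set f | value_is f x /\ odd (f 0) = odd (h 0)].
Proof.
move=> hb bh hx; apply/seteqP; split=> f.
  case=> g bg fg; have [gx og] := base_elt_value b h g x hb bh bg hx.
  split; first exact: approximable_value fg gx.
  by rewrite -og; have [s [as_ <-//]] := fg 1 isT; rewrite contractions_at0.
case=> fx of_; suff [g [bg gb f0 strict att]] : exists g,
    [/\ b g, digits_bounded theta g, f 0 = g 0,
    primary_aux theta g \/ ~ attains f x & attains g x -> attains f x].
  exists g => //; have [gx _] := base_elt_value b h g x hb bh bg hx.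
  exact: (value_approximable g f x).
case: hb bh => [[p wp bE]|[p wp bE]] bh; last first.
  rewrite bE in bh; case: bh => wh [ph /odd_sigma oh].
  (* The representative must match [f 0] itself, not only its parity. *)
  have hp : primary_aux theta (set_sign h (f 0)).
    by case: wh => wh _; exact: agree_primary (agree_set_sign _ _) wh.
  have gx := eq_value _ _ _ (agree_set_sign h (f 0)) hx.
  exists (set_sign h (f 0)).
  have bg : b (set_sign h (f 0)).
    rewrite bE; split.
      split=> // -[q wq hq]; apply: wh.2.
      exists (set_sign q.1 (h 0), set_sign q.2 (h 0)); first exact: W1_set_sign.
      by case: hq => hq; [left|right]; apply/funext => -[|n] //=; rewrite -hq.
    split; last by apply/odd_sigma; rewrite oh.
    by move=> n n0; rewrite ph //; exact: agree_set_sign.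
  split=> //; [by case: hp | by left |].
  (* A terminating representative with nonzero value would occur in a pair of [W1], which [W2]
     excludes; for value 0, already [psum f 0] attains it. *)
  move=> ax; have [x0|[h' wh']] := attains_primary _ _ hp gx ax.
    exists 0; apply/eqP; rewrite eq_le fx.1 x0 psum_ge0 //.
  case: wh => _ []; exists (set_sign (set_sign h (f 0)) (h 0), set_sign h' (h 0)).
    exact: (W1_set_sign (_, _)).
  by left; apply/funext => -[].
have wp' := W1_set_sign p (f 0) wp.
have [z _ [p1 p2 att natt]] := W1_value _ wp'.
have bp g : g = set_sign p.1 (f 0) \/ g = set_sign p.2 (f 0) -> b g.
  move=> gp; rewrite bE; exists (set_sign p.1 (f 0), set_sign p.2 (f 0)); split=> //.
  split=> /=; first exact: agree_set_sign.
  apply/odd_sigma; rewrite /= of_.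
  have bp1 : b p.1 by rewrite bE; exists p; split=> //; left.
  have [|_ ->//] := base_elt_value b h p.1 x _ bh bp1 hx.
  by left; exists p.
have zx : z = x.
  have [|p1x _] := base_elt_value b h _ x _ bh (bp _ (or_introl erefl)) hx.
    by left; exists p.
  exact: value_unique p1 p1x.
(* Take the terminating component if [f] attains its value, and the other one otherwise. *)
subst z; have [af|naf] := pselect (attains f x).
  exists (set_sign p.1 (f 0)); split=> //.
  - by apply: bp; left.
  - by case: wp' => -[].
  - by left; case: wp'.
exists (set_sign p.2 (f 0)); split=> //.
- by apply: bp; right.
- by case: wp' => _ [].
- by right.
Qed.

(** * Real numbers as fibres of the signed value *)

Lemma zero_primary h : (forall n, 0 < n -> h n = 0) -> primary_aux theta h.
Proof.
move=> h0; split=> [k k2|N N0].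
  by have := htheta k.-1; rewrite h0; lia.
by exists N.+1 => //; rewrite h0 //=; have := htheta N N0; lia.
Qed.

Lemma base_elt_ofP h : primary_aux theta h ->
  base_set theta (base_elt_of theta h) /\ base_elt_of theta h h.
Proof.
move=> hp; apply: (@xgetPex _ set0 [set b | base_set theta b /\ b h]).
exact: base_elt_ex.
Qed.

(** Pairs in [W1] have positive value, so a class of value 0 comes from [base_G2] and is determined
    by parity. *)
Lemma base_elt_zero b h : base_set theta b -> b h -> value_is h 0%R ->
  b = [set g | (forall n, 0 < n -> g n = 0) /\ odd (g 0) = odd (h 0)].
Proof.
move=> hb bh h0; apply/seteqP; split=> [g bg|g [g0 og]].
  by have [/value_0P] := base_elt_value b h g _ hb bh bg h0.
have W1n0 q f : W1 theta q -> f = q.1 \/ f = q.2 -> ~ value_is f 0%R.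
  move=> /W1_value [x x0 [q1 q2 _ _]] fq f0; move: x0.
  by case: fq f0 => -> f0; rewrite -(value_unique _ _ _ f0 (_ : value_is _ x)) ?ltxx.
move/value_0P in g0.
case: (hb) => [[q wq bE]|[q wq bE]].
  have bq : b q.1 by rewrite bE; exists q; split=> //; left.
  have [q0 _] := base_elt_value b h _ _ hb bh bq h0.
  by case: (W1n0 q q.1 wq (or_introl erefl)).
rewrite bE; have bq : b q by rewrite bE.
have [/value_0P q0 oq] := base_elt_value b h _ _ hb bh bq h0.
split; last first.
  split; last by apply/odd_sigma; rewrite og.
  by move/value_0P: g0 => g0 n n0; rewrite q0 // g0.
split; first by apply: zero_primary; exact/value_0P.
by case=> r wr gr; exact: W1n0 wr gr g0.
Qed.

(* Both parities of f 0 occur when r = 0, matching the definition of [0]. *)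
Definition signed_value (r : R) : set (nat -> nat) :=
  [set f | value_is f (if odd (f 0) then - r else r)%R].

Lemma signed_value_sign r f : r != 0%R -> signed_value r f -> odd (f 0) = (r < 0)%R.
Proof.
rewrite /signed_value /= => r0; case: (odd (f 0)) => /value_ge0 fr.
  by rewrite lt_neqAle r0 /=; lra.
by symmetry; apply/negbTE; rewrite -leNgt.
Qed.

Lemma signed_value_of f x : value_is f x ->
  signed_value (if odd (f 0) then - x else x)%R f.
Proof. by rewrite /signed_value /=; case: (odd (f 0)); rewrite ?opprK. Qed.

Lemma signed_value_ex r : exists h, primary_aux theta h /\ signed_value r h.
Proof.
(* The boolean [r < 0], read as 0 or 1, is the entry at 0, so it is odd exactly for negative [r]. *)
have [h [hp h0 hx]] := expansion_ex `|r|%R (r < 0)%R (normr_ge0 r).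
exists h; split=> //; rewrite /signed_value /= h0; case: ltrP hx => r0.
  by rewrite ltr0_norm.
by rewrite ger0_norm.
Qed.

Lemma signed_value_inj r s : signed_value r = signed_value s -> r = s.
Proof.
have [h [_ hr]] := signed_value_ex r => rs; have hs := hr; rewrite rs in hs.
have := value_unique _ _ _ hr hs; case: (odd _) => // E; lra.
Qed.

Lemma r_of_signed_value b h x : base_set theta b -> b h -> value_is h x -> x != 0%R ->
  r_of theta b = signed_value (if odd (h 0) then - x else x)%R.
Proof.
move=> hb bh hx x0; rewrite (r_of_value b h x) //.
apply/seteqP; split=> f /=; first by case=> fx <-; exact: signed_value_of.
move=> fx; have of_ : odd (f 0) = odd (h 0).
  have r0 : ((if odd (h 0) then - x else x) != 0)%R by case: odd; rewrite ?oppr_eq0.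
  by rewrite (signed_value_sign _ _ r0 fx) -(signed_value_sign _ _ r0 (signed_value_of h x hx)).
by move: fx; rewrite /signed_value /= of_; case: odd; rewrite ?opprK.
Qed.

Lemma real_zeroE : real_zero theta = signed_value 0%R.
Proof.
have rE h : (forall n, 0 < n -> h n = 0) ->
    r_of theta (base_elt_of theta h) = [set f | value_is f 0%R /\ odd (f 0) = odd (h 0)].
  move=> h0; have [hb bh] := base_elt_ofP h (zero_primary h h0).
  by apply: (r_of_value _ h) => //; apply/value_0P.
rewrite /real_zero /b1 /b2 !rE //; last by case.
apply/seteqP; split=> f; rewrite /signed_value /= oppr0 if_same.
  by case=> -[].
by case: (odd (f 0)) => f0; [right|left].
Qed.

Lemma realsP x : reals theta x <-> exists r, x = signed_value r.
Proof.
have b1E := base_elt_ofP (fun=> 0) (zero_primary (fun=> 0) (fun _ _ => erefl)).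
have e0 n : 0 < n -> (if n == 0 then 1 else 0) = 0 by case: n.
have b2E := base_elt_ofP _ (zero_primary _ e0).
have v1 : value_is (fun=> 0) 0%R by apply/value_0P.
have v2 : value_is (fun n => if n == 0 then 1 else 0) 0%R by apply/value_0P.
split=> [[[b [hb nb1 nb2 ->]]|->]|[r ->]].
- have [h [bh /digits_bounded_value [y hy]]] := base_elt_nonempty b hb.
  exists (if odd (h 0) then - y else y)%R; apply: r_of_signed_value => //.
  (* A class of value 0 would be [b2] or [b1], according to its parity. *)
  apply/eqP => y0; rewrite y0 in hy; have bE := base_elt_zero b h hb bh hy.
  case oh : (odd (h 0)); [apply: nb2|apply: nb1]; rewrite bE oh.
    by rewrite /b2 (base_elt_zero _ _ b2E.1 b2E.2 v2).
  by rewrite /b1 (base_elt_zero _ _ b1E.1 b1E.2 v1).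
- by exists 0%R; exact: real_zeroE.
have [->|r0] := eqVneq r 0%R; first by right; rewrite real_zeroE.
have [h [hp hr]] := signed_value_ex r.
have [b [hb bh]] := base_elt_ex h hp.
have hn0 : ~ value_is h 0%R.
  by move=> h0; have := value_unique _ _ _ hr h0; case: odd => E; case/eqP: r0; lra.
left; exists b; split=> //.
- move=> bE; apply: hn0; rewrite bE in bh.
  by have [] := base_elt_value _ _ h _ b1E.1 b1E.2 bh v1.
- move=> bE; apply: hn0; rewrite bE in bh.
  by have [] := base_elt_value _ _ h _ b2E.1 b2E.2 bh v2.
rewrite (r_of_signed_value b h _ hb bh hr); last by case: odd; rewrite ?oppr_eq0.
by case: odd; rewrite ?opprK.
Qed.

Lemma reals_starP r : reals_star theta (signed_value r) <-> r != 0%R.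
Proof.
split=> [[_ nz]|r0]; first by apply/eqP => r0; apply: nz; rewrite r0 real_zeroE.
split; first by apply/realsP; exists r.
by rewrite real_zeroE => /signed_value_inj /eqP; exact/negP.
Qed.

Lemma real_sigmaE r : r != 0%R -> real_sigma (signed_value r) = if (r < 0)%R then 0 else 1.
Proof.
move=> r0; have [h [_ hr]] := signed_value_ex r.
have xr : signed_value r (xget (fun=> 0) (signed_value r)) by apply: xgetPex; exists h.
by rewrite /real_sigma /sigma (signed_value_sign _ _ r0 xr).
Qed.

(** * The order and completeness *)

(** Adding digitwise an expansion of [y - x] needs no carrying, since elements of a real number may
    have arbitrarily large digits. *)
Lemma dominating_ex f x y : value_is f x -> (x <= y)%R ->
  exists g, [/\ value_is g y, g 0 = f 0 & forall n, 0 < n -> f n <= g n].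
Proof.
rewrite -subr_ge0 => fx /(expansion_ex _ 0) [h [_ h0 hx]].
exists (fun n => f n + h n); split.
- by have := value_add _ _ _ _ fx hx; rewrite subrKC.
- by rewrite h0 addn0.
- by move=> n _; rewrite leq_addr.
Qed.

(** Pointwise domination is monotone in the value, and [dominating_ex] gives the converse. For
    negative numbers the values are [- r] and [- s], which explains the reversed clause. *)
Lemma real_le_starP r s : r != 0%R -> s != 0%R ->
  real_le_star (signed_value r) (signed_value s) <-> (r <= s)%R.
Proof.
move=> r0 s0; rewrite /real_le_star !real_sigmaE //.
have [f [_ fr]] := signed_value_ex r; have [g [_ gs]] := signed_value_ex s.
have /= og := signed_value_sign _ _ s0 gs; have /= of_ := signed_value_sign _ _ r0 fr.
have [rneg|rpos] := ltrP r 0%R; have [sneg|spos] := ltrP s 0%R; split.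
- case=> [//|[//]|[_ _ H]].
  have [a ar ag] := H g gs; have := value_homo _ _ _ _ ag gs ar.
  by rewrite (signed_value_sign _ _ r0 ar) og rneg sneg; lra.
- move=> rs; apply: Or33; split=> // b bs; have ob := signed_value_sign _ _ s0 bs.
  move: bs; rewrite /signed_value /= ob sneg => bs.
  have [|a [ar a0 ab]] := dominating_ex b (- s)%R (- r)%R bs; first lra.
  by exists a; rewrite //= a0 ob sneg.
- by move=> _; lra.
- by move=> _; apply: Or31.
- by case=> [//|[]//|[]].
- by move=> rs; exfalso; lra.
- case=> [//|[_ _ H]|[]//].
  have [b bs fb] := H f fr; have := value_homo _ _ _ _ fb fr bs.
  by rewrite (signed_value_sign _ _ s0 bs) of_ !ltNge rpos spos.
- move=> rs; apply: Or32; split=> // a ar; have oa := signed_value_sign _ _ r0 ar.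
  move: ar; rewrite /signed_value /= oa ltNge rpos /= => ar.
  have [b [bs b0 ab]] := dominating_ex a r s ar rs.
  by exists b; rewrite //= b0 oa ltNge rpos.
Qed.

Lemma real_leP r s : real_le theta (signed_value r) (signed_value s) <-> (r <= s)%R.
Proof.
rewrite /real_le real_zeroE.
have [->|r0] := eqVneq r 0%R; have [->|s0] := eqVneq s 0%R; split.
- by [].
- by move=> _; apply: Or44.
- case=> [[/reals_starP/eqP//]|[/reals_starP/eqP//]|[_ _]|[_ /signed_value_inj/eqP]].
    by rewrite real_sigmaE // leNgt; case: (s < 0)%R.
  by rewrite (negbTE s0).
- move=> s1; apply: Or43; split=> //; first exact/reals_starP.
  by rewrite real_sigmaE // ltNge s1.
- case=> [[_ /reals_starP/eqP//]|[_ _]|[_ /reals_starP/eqP//]|[/signed_value_inj/eqP]].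
    by rewrite real_sigmaE //; case: ltrP => // /ltW.
  by rewrite (negbTE r0).
- move=> r1; apply: Or42; split=> //; first exact/reals_starP.
  by rewrite real_sigmaE // lt_neqAle r0 r1.
- case=> [[_ _ /real_le_starP]|[_ /signed_value_inj/eqP]
          |[/signed_value_inj/eqP]|[/signed_value_inj/eqP]];
  rewrite ?(negbTE r0) ?(negbTE s0) //; exact.
- by move=> rs; apply: Or41; split; [exact/reals_starP|exact/reals_starP|exact/real_le_starP].
Qed.

End Positional.

Theorem mainTheorem6 (theta : nat -> nat) (htheta : system_function theta)
    (S : set (set (nat -> nat))) (S_reals : S `<=` reals theta)
    (S_nonempty : S !=set0)
    (S_bounded : exists u, is_upper_bound theta S u) :
  exists l, is_least_upper_bound theta S l.
Proof.
(* The standard reals serve as the complete field of values; [V] transports their suprema. *)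
pose V (r : Rdefinitions.R) := signed_value theta r.
have reals_V x : reals theta x <-> exists r, x = V r by exact: realsP.
have le_V r s : real_le theta (V r) (V s) <-> (r <= s)%R by exact: real_leP.
pose T := [set r | S (V r)].
have [u [/reals_V [ur ->] Su]] := S_bounded.
have Sval x : S x -> exists2 r, x = V r & T r.
  by move=> Sx; have /reals_V [r xr] := S_reals x Sx; exists r; rewrite // /T /= -xr.
have T0 : T !=set0 by have [x /Sval [r _ Tr]] := S_nonempty; exists r.
have Tub : has_ubound T by exists ur => r /Su /le_V.
exists (V (sup T)); split.
  split; first by apply/reals_V; exists (sup T).
  by move=> _ /Sval [r -> Tr]; apply/le_V; exact: ub_le_sup.
by move=> _ [/reals_V [w ->] Sw]; apply/le_V; apply: ge_sup => // r /Sw /le_V.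
Qed.
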